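(* Let $({\bf H}^n,{\bf E}^n)_{0\le n\le M}$ be the solution of the scheme $$\mu\,\frac{{\bf H}^{n+1}-{\bf H}^n}{\tau}=-\hat{\bf D}\,\frac{{\bf E}^{n+1}+{\bf E}^n}{2},\qquad \epsilon\,\frac{{\bf E}^{n+1}-{\bf E}^n}{\tau}=\hat{\bf D}\,\frac{{\bf H}^{n+1}+{\bf H}^n}{2},\qquad n=0,\dots,M-1 .$$ Then the following discrete energy conservation laws hold: $$\mathcal E_1^{n+1}=\mathcal E_1^n,\qquad \mathcal E_1^n=\frac1{2\epsilon}\langle{\bf H}^n,{\bf D}{\bf H}^n\rangle_h+\frac1{2\mu}\langle{\bf E}^n,{\bf D}{\bf E}^n\rangle_h,\qquad n=0,\dots,M-1,$$ and $$\mathcal E_2^{n+1}=\mathcal E_2^n,\qquad \mathcal E_2^n=\frac{\mu}{2}\|{\bf H}^n\|_h^2+\frac{\epsilon}{2}\|{\bf E}^n\|_h^2,\qquad n=0,\dots,M-1.$$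
   Context: Grid: $N_x,N_y,N_z$ are even positive integers, the domain is $[x_L,x_R]\times[y_L,y_R]\times[z_L,z_R]$, $L_w=w_R-w_L$, $h_w=L_w/N_w$, $\mu_w=2\pi/L_w$ for $w\in\{x,y,z\}$; $w_j=w_L+(j-1)h_w$, $j=1,\dots,N_w$. Time step $\tau=T/M$, $T>0$, $M$ a positive integer. $\epsilon,\mu>0$ are constants and $c=1/\sqrt{\epsilon\mu}$. Put $s_1=N_xN_yN_z$. ${\bf D}_1^w\in\mathbb R^{N_w\times N_w}$ is the Fourier spectral first-order differentiation matrix: $({\bf D}_1^w)_{j,l}=\tfrac12\mu_w(-1)^{j+l}\cot\big(\mu_w\tfrac{w_j-w_l}{2}\big)$ for $j\ne l$, and $({\bf D}_1^w)_{j,j}=0$. Put ${\bf D}_1={\bf I}_{N_z}\otimes{\bf I}_{N_y}\otimes{\bf D}_1^x$, ${\bf D}_2={\bf I}_{N_z}\otimes{\bf D}_1^y\otimes{\bf I}_{N_x}$, ${\bf D}_3={\bf D}_1^z\otimes{\bf I}_{N_y}\otimes{\bf I}_{N_x}$ ($\otimes$ the Kronecker product), acting on grid functions $U_{j,k,m}$ ordered as vectors in $\mathbb R^{s_1}$ with $j$ varying fastest, then $k$, then $m$. Let $${\bf D}=\begin{pmatrix}0&-{\bf D}_3&{\bf D}_2\\ {\bf D}_3&0&-{\bf D}_1\\ -{\bf D}_2&{\bf D}_1&0\end{pmatrix},\qquad \hat{\bf D}={\bf D}+\frac{c^2\tau^2}{12}{\bf D}^3+\frac{c^4\tau^4}{120}{\bf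 D}^5 .$$ Unknowns ${\bf H}^n=(({\bf H}_x^n)^T,({\bf H}_y^n)^T,({\bf H}_z^n)^T)^T$ and ${\bf E}^n=(({\bf E}_x^n)^T,({\bf E}_y^n)^T,({\bf E}_z^n)^T)^T$ lie in $\mathbb R^{3s_1}$. For grid functions, $\langle{\bf U},{\bf V}\rangle_h=h_xh_yh_z\sum_{j,k,m}U_{j,k,m}\overline{V_{j,k,m}}$; for three-component vectors $\langle{\bf U},{\bf V}\rangle_h=\sum_{w\in\{x,y,z\}}\langle{\bf U}_w,{\bf V}_w\rangle_h$; $\|{\bf U}\|_h^2=\langle{\bf U},{\bf U}\rangle_h$. *)

(* Defs.v *)
(* Grid indices are 0-based: the node w_j, j = 1..N, is indexed by j - 1. *)
From mathcomp Require Import all_boot all_order all_algebra.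
From mathcomp Require Import mxtens.
From mathcomp Require Import reals trigo.

Set Implicit Arguments.
Unset Strict Implicit.
Unset Printing Implicit Defensive.

Import Order.TTheory GRing.Theory Num.Theory.
Local Open Scope ring_scope.

Definition cot {R : realType} (x : R) : R := cos x / sin x.

Definition mesh_size {R : realType} (a b : R) (N : nat) : R := (b - a) / N%:R.

Definition wave_number {R : realType} (a b : R) : R := 2 * pi / (b - a).

Definition grid_node {R : realType} (a b : R) (N : nat) (j : 'I_N) : R :=
  a + j%:R * mesh_size a b N.

(* The sign (-1)^(j+l) is unaffected by shifting both indices by one. *)
Definition fourier_D1 {R : realType} (a b : R) (N : nat) : 'M[R]_N :=
  \matrix_(j < N, l < N)
    if j == l then 0
    else 2^-1 * wave_number a b * (-1) ^+ (j + l)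
         * cot (wave_number a b * ((grid_node a b j - grid_node a b l) / 2)).

(* The number of grid points, bracketed to match the Kronecker products below. *)
Definition grid_size (Nx Ny Nz : nat) : nat := (Nz * (Ny * Nx))%N.

(* [mxtens_index (p, q)] has value p * n + q for q < n, so j varies fastest,
   then k, then m. *)
Definition grid_index {Nx Ny Nz : nat} (j : 'I_Nx) (k : 'I_Ny) (m : 'I_Nz) :
    'I_(grid_size Nx Ny Nz) :=
  mxtens_index (m, mxtens_index (k, j)).

Definition grid_D1 {R : realType} (xL xR : R) (Nx Ny Nz : nat) :
    'M[R]_(grid_size Nx Ny Nz) :=
  (1%:M : 'M[R]_Nz) *t ((1%:M : 'M[R]_Ny) *t fourier_D1 xL xR Nx).

Definition grid_D2 {R : realType} (yL yR : R) (Nx Ny Nz : nat) :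
    'M[R]_(grid_size Nx Ny Nz) :=
  (1%:M : 'M[R]_Nz) *t (fourier_D1 yL yR Ny *t (1%:M : 'M[R]_Nx)).

Definition grid_D3 {R : realType} (zL zR : R) (Nx Ny Nz : nat) :
    'M[R]_(grid_size Nx Ny Nz) :=
  fourier_D1 zL zR Nz *t ((1%:M : 'M[R]_Ny) *t (1%:M : 'M[R]_Nx)).

(* The dimension 3 s is written s + (s + s), for use with block matrices. *)
Definition field_size (Nx Ny Nz : nat) : nat :=
  (grid_size Nx Ny Nz + (grid_size Nx Ny Nz + grid_size Nx Ny Nz))%N.

Definition curl_block {R : realType} (s : nat) (D1 D2 D3 : 'M[R]_s) :
    'M[R]_(s + (s + s)) :=
  block_mx 0                (row_mx (- D3) D2)
           (col_mx D3
                   (- D2))  (block_mx 0  (- D1)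
                                      D1 0).

Definition curl_mx {R : realType} (xL xR yL yR zL zR : R) (Nx Ny Nz : nat) :
    'M[R]_(field_size Nx Ny Nz) :=
  curl_block (grid_D1 xL xR Nx Ny Nz) (grid_D2 yL yR Nx Ny Nz)
             (grid_D3 zL zR Nx Ny Nz).

Definition light_speed {R : realType} (epsilon mu : R) : R :=
  1 / Num.sqrt (epsilon * mu).

Definition modified_curl {R : realType} (c tau : R) (n : nat) (D : 'M[R]_n) :
    'M[R]_n :=
  D + (c ^+ 2 * tau ^+ 2 / 12) *: D ^+ 3
    + (c ^+ 4 * tau ^+ 4 / 120) *: D ^+ 5.

Definition field_x {R : realType} {Nx Ny Nz : nat}
    (U : 'cV[R]_(field_size Nx Ny Nz)) : 'cV[R]_(grid_size Nx Ny Nz) :=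
  usubmx U.

Definition field_y {R : realType} {Nx Ny Nz : nat}
    (U : 'cV[R]_(field_size Nx Ny Nz)) : 'cV[R]_(grid_size Nx Ny Nz) :=
  usubmx (dsubmx U).

Definition field_z {R : realType} {Nx Ny Nz : nat}
    (U : 'cV[R]_(field_size Nx Ny Nz)) : 'cV[R]_(grid_size Nx Ny Nz) :=
  dsubmx (dsubmx U).

(* Grid functions are real, so no conjugation appears; [v] is the volume
   hx hy hz of a grid cell. *)
Definition grid_dot {R : realType} {Nx Ny Nz : nat} (v : R)
    (U V : 'cV[R]_(grid_size Nx Ny Nz)) : R :=
  v * \sum_(j < Nx) \sum_(k < Ny) \sum_(m < Nz)
        U (grid_index j k m) 0 * V (grid_index j k m) 0.

Definition field_dot {R : realType} {Nx Ny Nz : nat} (v : R)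
    (U V : 'cV[R]_(field_size Nx Ny Nz)) : R :=
  grid_dot v (field_x U) (field_x V) + grid_dot v (field_y U) (field_y V)
  + grid_dot v (field_z U) (field_z V).

Definition field_norm {R : realType} {Nx Ny Nz : nat} (v : R)
    (U : 'cV[R]_(field_size Nx Ny Nz)) : R :=
  Num.sqrt (field_dot v U U).

Definition energy1 {R : realType} {Nx Ny Nz : nat} (epsilon mu v : R)
    (D : 'M[R]_(field_size Nx Ny Nz)) (H E : 'cV[R]_(field_size Nx Ny Nz)) : R :=
  1 / (2 * epsilon) * field_dot v H (D *m H)
  + 1 / (2 * mu) * field_dot v E (D *m E).

Definition energy2 {R : realType} {Nx Ny Nz : nat} (epsilon mu v : R)
    (H E : 'cV[R]_(field_size Nx Ny Nz)) : R :=
  mu / 2 * field_norm v H ^+ 2 + epsilon / 2 * field_norm v E ^+ 2.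

(* One time step, from (H0, E0) to (H1, E1). *)
Definition scheme_step {R : realType} (epsilon mu tau : R) (n : nat)
    (Dhat : 'M[R]_n) (H0 E0 H1 E1 : 'cV[R]_n) : Prop :=
  mu *: (tau^-1 *: (H1 - H0)) = - (Dhat *m (2^-1 *: (E1 + E0))) /\
  epsilon *: (tau^-1 *: (E1 - E0)) = Dhat *m (2^-1 *: (H1 + H0)).

(* Main.v *)
Require Import Defs.
From mathcomp Require Import all_boot all_order all_algebra.
From mathcomp Require Import mxtens ring.
From mathcomp Require Import reals trigo.

Set Implicit Arguments.
Unset Strict Implicit.
Unset Printing Implicit Defensive.

Import Order.TTheory GRing.Theory Num.Theory.
Local Open Scope ring_scope.

(** Both laws are one computation.  Each Fourier matrix is antisymmetric,
    because the cotangent is odd; so are its Kronecker products with identity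
    matrices, and the sign pattern of the discrete curl turns three antisymmetric
    blocks into a symmetric matrix D.  The operator Dhat of the scheme is a
    polynomial in D, hence symmetric and commuting with D.

    Let K be any symmetric matrix that commutes with Dhat.  Pairing the increments
    H1 - H0 and E1 - E0 with K applied to the sums H1 + H0 and E1 + E0 gives, on
    the left, mu and epsilon times the increments of the quadratic forms H^T K H
    and E^T K E (a difference of squares) and, on the right, the numbers
    -(tau/2) (H1 + H0)^T K Dhat (E1 + E0) and (tau/2) (E1 + E0)^T K Dhat (H1 + H0).
    The two add up to zero because K Dhat is symmetric, so
    mu H^T K H + epsilon E^T K E is conserved ([scheme_step_conserves]).  The first
    law is the case K = D, divided by 2 epsilon mu; the second is the case K = 1,
    divided by 2.  The grid inner product is a multiple of the Euclidean one
    ([field_dotE]), which carries these identities to the energies. *)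

Lemma cotN (R : realType) (x : R) : cot (- x) = - cot x.
Proof. by rewrite /cot cosN sinN invrN mulrN. Qed.

Lemma tr_fourier_D1 (R : realType) (a b : R) N :
  (fourier_D1 a b N)^T = - fourier_D1 a b N.
Proof.
apply/matrixP=> i j; rewrite !mxE eq_sym.
case: eqP => _; first by rewrite oppr0.
by rewrite -opprB mulNr mulrN cotN mulrN addnC.
Qed.

Lemma tensmxN (R : pzRingType) m n p q (A : 'M[R]_(m, n)) (B : 'M[R]_(p, q)) :
  A *t (- B) = - (A *t B).
Proof. by apply/matrixP=> i j; rewrite !mxE mulrN. Qed.

Lemma tensNmx (R : pzRingType) m n p q (A : 'M[R]_(m, n)) (B : 'M[R]_(p, q)) :
  (- A) *t B = - (A *t B).
Proof. by apply/matrixP=> i j; rewrite !mxE mulNr. Qed.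

(** Transposing the block matrix exchanges opposite off-diagonal blocks, which
    differ by a sign; the antisymmetry of the blocks cancels that sign. *)
Lemma tr_curl_block (R : realType) s (D1 D2 D3 : 'M[R]_s) :
    D1^T = - D1 -> D2^T = - D2 -> D3^T = - D3 ->
  (curl_block D1 D2 D3)^T = curl_block D1 D2 D3.
Proof.
move=> t1 t2 t3; rewrite /curl_block tr_block_mx tr_row_mx tr_col_mx tr_block_mx.
by rewrite !trmx0 !linearN /= t1 t2 t3 !opprK.
Qed.

Lemma tr_curl_mx (R : realType) (xL xR yL yR zL zR : R) Nx Ny Nz :
  (curl_mx xL xR yL yR zL zR Nx Ny Nz)^T = curl_mx xL xR yL yR zL zR Nx Ny Nz.
Proof.
apply: tr_curl_block;
  by rewrite !trmx_tens !trmx1 tr_fourier_D1 ?tensNmx ?tensmxN.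
Qed.

Lemma trmx_expr (R : comPzRingType) n (A : 'M[R]_n) k : (A ^+ k)^T = A^T ^+ k.
Proof.
elim: k => [|k IHk]; first by rewrite !expr0 trmx1.
by rewrite exprSr exprS -!mulmxE trmx_mul IHk.
Qed.

Lemma tr_modified_curl (R : realType) (c tau : R) n (D : 'M[R]_n) :
  D^T = D -> (modified_curl c tau D)^T = modified_curl c tau D.
Proof.
by move=> tD; rewrite /modified_curl !(linearD, linearZ) /= !trmx_expr tD.
Qed.

Lemma modified_curl_comm (R : realType) (c tau : R) n (D : 'M[R]_n) :
  D *m modified_curl c tau D = modified_curl c tau D *m D.
Proof.
rewrite /modified_curl !mulmxDl !mulmxDr -!scalemxAl -!scalemxAr.
by rewrite !mulmxE -!exprS -!exprSr.
Qed.

Lemma trmx_form (R : comPzRingType) n (K : 'M[R]_n) (U V : 'cV[R]_n) :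
  U^T *m K *m V = V^T *m K^T *m U.
Proof.
have tr11 (A : 'M[R]_1) : A^T = A by apply/matrixP=> i j; rewrite mxE !ord1.
by rewrite -[LHS]tr11 !trmx_mul trmxK mulmxA.
Qed.

(** The difference of squares: symmetry of K cancels the two mixed terms. *)
Lemma form_subr (R : comPzRingType) n (K : 'M[R]_n) (U V : 'cV[R]_n) :
  K^T = K ->
  U^T *m K *m U - V^T *m K *m V = (U + V)^T *m K *m (U - V).
Proof.
move=> tK; rewrite [(U + V)^T]linearD /= !mulmxDl !mulmxBr.
have -> : V^T *m K *m U = U^T *m K *m V by rewrite trmx_form tK.
by rewrite addrA subrK.
Qed.

(** Each half of the scheme moves one field along A applied to the sum of the
    other field over the step.  So the increments of the two terms are tau/2 times,
    with opposite signs, the values of the form K A at the two sums taken in either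
    order, and symmetry of K A makes them cancel. *)
Lemma scheme_step_conserves (R : realType) (epsilon mu tau : R) n
    (A K : 'M[R]_n) (H0 E0 H1 E1 : 'cV[R]_n) :
    tau != 0 -> A^T = A -> K^T = K -> K *m A = A *m K ->
    scheme_step epsilon mu tau A H0 E0 H1 E1 ->
  mu *: (H1^T *m K *m H1) + epsilon *: (E1^T *m K *m E1) =
  mu *: (H0^T *m K *m H0) + epsilon *: (E0^T *m K *m E0).
Proof.
move=> tau0 tA tK KA [stepH stepE].
have incH : mu *: (H1 - H0) = - ((tau / 2) *: (A *m (E1 + E0))).
  move/(congr1 ( *:%R tau)): stepH.
  rewrite !scalerA mulrAC mulfV // mul1r => ->.
  by rewrite scalerN -scalemxAr scalerA.
have incE : epsilon *: (E1 - E0) = (tau / 2) *: (A *m (H1 + H0)).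
  move/(congr1 ( *:%R tau)): stepE.
  rewrite !scalerA mulrAC mulfV // mul1r => ->.
  by rewrite -scalemxAr scalerA.
apply/eqP; rewrite -subr_eq0 opprD addrACA -!scalerBr !form_subr //.
rewrite !(scalemxAr _ (_ *m K)) incH incE mulmxN -!scalemxAr addrC subr_eq0.
by rewrite !mulmxA -!(mulmxA _ K A) trmx_form trmx_mul tA tK KA.
Qed.

Lemma sum_mxtens_index (V : nmodType) m n (F : 'I_(m * n) -> V) :
  \sum_i F i = \sum_(p < m) \sum_(q < n) F (mxtens_index (p, q)).
Proof.
rewrite pair_bigA (reindex (@mxtens_index m n)); first by apply: eq_bigr => -[].
by exists (@mxtens_unindex m n) => ? _; rewrite (mxtens_indexK, mxtens_unindexK).
Qed.

(** The nested sums run over j, k, m, while the vector index varies fastest in j: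
    both sides agree after exchanging summations. *)
Lemma grid_dotE (R : realType) Nx Ny Nz (v : R)
    (U V : 'cV[R]_(grid_size Nx Ny Nz)) :
  grid_dot v U V = v * (U^T *m V) 0 0.
Proof.
congr (v * _); rewrite mxE sum_mxtens_index.
under [RHS]eq_bigr do rewrite sum_mxtens_index exchange_big /=.
rewrite [RHS]exchange_big /=; apply: eq_bigr => j _.
rewrite [RHS]exchange_big /=; apply: eq_bigr => k _.
by apply: eq_bigr => m _; rewrite mxE.
Qed.

Lemma field_dotE (R : realType) Nx Ny Nz (v : R)
    (U V : 'cV[R]_(field_size Nx Ny Nz)) :
  field_dot v U V = v * (U^T *m V) 0 0.
Proof.
rewrite /field_dot !grid_dotE /field_x /field_y /field_z.
rewrite -[in RHS](vsubmxK U) -[in RHS](vsubmxK V).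
rewrite -[in RHS](vsubmxK (dsubmx U)) -[in RHS](vsubmxK (dsubmx V)).
by rewrite !tr_col_mx !mul_row_col !mxE !mulrDr addrA.
Qed.

(** The square root is zero on negative numbers, so the cell volume must have a
    sign. *)
Lemma sqr_field_norm (R : realType) Nx Ny Nz (v : R)
    (U : 'cV[R]_(field_size Nx Ny Nz)) :
  0 <= v -> field_norm v U ^+ 2 = field_dot v U U.
Proof.
move=> v_ge0; rewrite sqr_sqrtr // field_dotE mulr_ge0 // mxE.
by apply: sumr_ge0 => i _; rewrite mxE -expr2 sqr_ge0.
Qed.

Lemma mesh_size_ge0 (R : realType) (a b : R) N : a < b -> 0 <= mesh_size a b N.
Proof. by move=> ab; rewrite divr_ge0 ?ler0n // subr_ge0 ltW. Qed.

Theorem theorem4p2 (R : realType) (Nx Ny Nz M : nat)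
    (xL xR yL yR zL zR T epsilon mu : R)
    (Nx_gt0 : (0 < Nx)%N) (Ny_gt0 : (0 < Ny)%N) (Nz_gt0 : (0 < Nz)%N)
    (Nx_even : ~~ odd Nx) (Ny_even : ~~ odd Ny) (Nz_even : ~~ odd Nz)
    (x_lt : xL < xR) (y_lt : yL < yR) (z_lt : zL < zR)
    (T_gt0 : 0 < T) (M_gt0 : (0 < M)%N)
    (epsilon_gt0 : 0 < epsilon) (mu_gt0 : 0 < mu)
    (H E : nat -> 'cV[R]_(field_size Nx Ny Nz)) :
  let tau := T / M%:R in
  let c := light_speed epsilon mu in
  let D := curl_mx xL xR yL yR zL zR Nx Ny Nz in
  let Dhat := modified_curl c tau D in
  let v := mesh_size xL xR Nx * mesh_size yL yR Ny * mesh_size zL zR Nz in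
  (forall n, (n < M)%N ->
    scheme_step epsilon mu tau Dhat (H n) (E n) (H n.+1) (E n.+1)) ->
  (forall n, (n < M)%N ->
    energy1 epsilon mu v D (H n.+1) (E n.+1) = energy1 epsilon mu v D (H n) (E n)) /\
  (forall n, (n < M)%N ->
    energy2 epsilon mu v (H n.+1) (E n.+1) = energy2 epsilon mu v (H n) (E n)).
Proof.
move=> tau c D Dhat v step.
have tau0 : tau != 0 by rewrite gt_eqF // divr_gt0 // ltr0n.
have mu0 : mu != 0 by rewrite gt_eqF.
have epsilon0 : epsilon != 0 by rewrite gt_eqF.
have v_ge0 : 0 <= v by apply: (mulr_ge0 (mulr_ge0 _ _)); exact: mesh_size_ge0.
have tD : D^T = D by exact: tr_curl_mx.
have tDhat : Dhat^T = Dhat by exact: tr_modified_curl.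
pose q K (U : 'cV[R]_(field_size Nx Ny Nz)) := (U^T *m K *m U) 0 0.
have conserved K n : (n < M)%N -> K^T = K -> K *m Dhat = Dhat *m K ->
    mu * q K (H n.+1) + epsilon * q K (E n.+1) =
    mu * q K (H n) + epsilon * q K (E n).
  move=> ltnM tK comK.
  have /matrixP/(_ 0 0) :=
    @scheme_step_conserves _ _ _ _ _ _ _ _ _ _ _ tau0 tDhat tK comK (step n ltnM).
  by rewrite /q !mxE.
split=> n ltnM.
- have energy1E (U V : 'cV[R]_(field_size Nx Ny Nz)) :
      energy1 epsilon mu v D U V
      = v / (2 * epsilon * mu) * (mu * q D U + epsilon * q D V).
    by rewrite /energy1 !field_dotE !mulmxA -!/(q _ _); field; rewrite mu0 epsilon0.
  by rewrite !energy1E conserved //; exact: modified_curl_comm.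
have energy2E (U V : 'cV[R]_(field_size Nx Ny Nz)) :
    energy2 epsilon mu v U V = v / 2 * (mu * q 1%:M U + epsilon * q 1%:M V).
  rewrite /energy2 !sqr_field_norm // !field_dotE /q !mulmx1.
  by field.
by rewrite !energy2E conserved // ?trmx1 // mulmx1 mul1mx.
Qed.
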